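(* Let $b=\alpha+i\beta$ with $\alpha,\beta\in\mathbb{R}$ and $b\neq 1\pm2\sqrt2$, and put $$\nu(\alpha)=\sqrt{\frac{-95+14\alpha-15\alpha^2+4\sqrt{2(35-160\alpha+173\alpha^2)}}{15}}.$$ The fixed point $z=1$ of $O_b$ satisfies the following statements. (a) The fixed point $z=1$ is attractive if $$\alpha\in\left(\tfrac{1}{3}\left(1-2\sqrt{13}\right),\tfrac{1}{5}\left(3-2\sqrt{41}\right)\right)\cup\left(\tfrac{1}{3}\left(1+2\sqrt{13}\right),\tfrac{1}{5}\left(3+2\sqrt{41}\right)\right)$$ and $\beta\in(-\nu(\alpha),\nu(\alpha))$. It is a superattractor if $b=-2$ or $b=3$. (b) The fixed point $z=1$ is indifferent if $$\alpha\in\left[\tfrac{1}{3}\left(1-2\sqrt{13}\right),\tfrac{1}{5}\left(3-2\sqrt{41}\right)\right]\cup\left[\tfrac{1}{3}\left(1+2\sqrt{13}\right),\tfrac{1}{5}\left(3+2\sqrt{41}\right)\right]$$ and $\beta=\pm\nu(\alpha)$. (c) The fixed point $z=1$ is repulsive for any other value of $b\in\mathbb{C}$, $b\neq 1\pm 2\sqrt 2$.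
   Context: For $b\in\mathbb{C}$, $O_b:\widehat{\mathbb{C}}\to\widehat{\mathbb{C}}$ is the rational map (after cancelling common factors) $$O_b(z)=z^4\,\frac{-11-6b+b^2+(-3+2b+b^2)z}{-3+2b+b^2+(-11-6b+b^2)z}.$$ For $b\neq1\pm2\sqrt2$ the point $z=1$ is a fixed point of $O_b$. A fixed point $z_0$ of a rational map $R$ with multiplier $\lambda=R'(z_0)$ is attractive if $|\lambda|<1$, a superattractor if $\lambda=0$, indifferent if $|\lambda|=1$, and repulsive if $|\lambda|>1$. *)

(* Defs.v *)
From mathcomp Require Import all_boot all_order all_algebra.
From mathcomp Require Import all_classical all_reals all_analysis.
From mathcomp Require Import complex.

Set Implicit Arguments.
Unset Strict Implicit.
Unset Printing Implicit Defensive.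

Import Order.TTheory GRing.Theory Num.Theory.
Import numFieldNormedType.Exports.

Local Open Scope ring_scope.
Local Open Scope complex_scope.

(* The Riemann sphere; [Some z] is the finite point z and [None] is infinity. *)
Definition sphere (R : realType) : Type := one_point_compactification R[i].

(* The self-map of the sphere induced by p / q (with q <> 0) after cancelling
   common factors.  Finite zeros of the reduced denominator go to infinity; the
   value at infinity is the limit of the reduced fraction, which is read off
   from its coefficients of degree [(size d).-1], the degree of d. *)
Definition ratmap (R : realType) (p q : {poly R[i]}) (x : sphere R) : sphere R :=
  let n := p %/ gcdp p q in
  let d := q %/ gcdp p q in
  match x with
  | Some z => if d.[z] == 0 then None else Some (n.[z] / d.[z])
  | None => if (size d < size n)%N then None
            else Some (n`_(size d).-1 / lead_coef d)
  end.

Definition Oop_num (R : realType) (b : R[i]) : {poly R[i]} :=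
  'X^4 * ((- 11 - 6 * b + b ^+ 2)%:P + (- 3 + 2 * b + b ^+ 2)%:P * 'X).

Definition Oop_den (R : realType) (b : R[i]) : {poly R[i]} :=
  (- 3 + 2 * b + b ^+ 2)%:P + (- 11 - 6 * b + b ^+ 2)%:P * 'X.

Definition Oop (R : realType) (b : R[i]) : sphere R -> sphere R :=
  ratmap (Oop_num b) (Oop_den b).

(* A map of the sphere read in the affine coordinate; the value 0 given at the
   poles is immaterial near a finite fixed point of a rational map. *)
Definition affine_part (R : realType) (f : sphere R -> sphere R) (z : R[i]) :
  R[i] := odflt 0 (f (Some z)).

(* z0 is a finite fixed point of f and f'(z0) exists and equals lambda.  The
   scalar field of [is_derive] is R[i], so this is the complex derivative. *)
Definition fixed_with_multiplier (R : realType) (f : sphere R -> sphere R)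
    (z0 lambda : R[i]) : Prop :=
  f (Some z0) = Some z0 /\
  is_derive (z0 : R[i]^o) (1 : R[i]^o)
    (affine_part f : R[i]^o -> R[i]^o) (lambda : R[i]^o).

Definition attractive (R : realType) (f : sphere R -> sphere R) (z0 : R[i]) :
  Prop := exists2 lambda, fixed_with_multiplier f z0 lambda & `|lambda| < 1.

Definition superattractor (R : realType) (f : sphere R -> sphere R)
    (z0 : R[i]) : Prop :=
  exists2 lambda, fixed_with_multiplier f z0 lambda & lambda = 0.

Definition indifferent (R : realType) (f : sphere R -> sphere R) (z0 : R[i]) :
  Prop := exists2 lambda, fixed_with_multiplier f z0 lambda & `|lambda| = 1.

Definition repulsive (R : realType) (f : sphere R -> sphere R) (z0 : R[i]) :
  Prop := exists2 lambda, fixed_with_multiplier f z0 lambda & 1 < `|lambda|.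

Definition nu (R : realType) (a : R) : R :=
  Num.sqrt ((- 95 + 14 * a - 15 * a ^+ 2
             + 4 * Num.sqrt (2 * (35 - 160 * a + 173 * a ^+ 2))) / 15).

Definition attracting_region (R : realType) (alpha beta : R) : Prop :=
  ((alpha \in `]((1 - 2 * Num.sqrt 13) / 3), ((3 - 2 * Num.sqrt 41) / 5)[)
   \/ (alpha \in `]((1 + 2 * Num.sqrt 13) / 3), ((3 + 2 * Num.sqrt 41) / 5)[))
  /\ beta \in `](- nu alpha), (nu alpha)[.

Definition indifferent_region (R : realType) (alpha beta : R) : Prop :=
  ((alpha \in `[((1 - 2 * Num.sqrt 13) / 3), ((3 - 2 * Num.sqrt 41) / 5)])
   \/ (alpha \in `[((1 + 2 * Num.sqrt 13) / 3), ((3 + 2 * Num.sqrt 41) / 5)]))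
  /\ (beta = nu alpha \/ beta = - nu alpha).

(* Main.v *)
(* Away from the zeros of its denominator, [Oop b] is the quotient of its
   uncancelled numerator and denominator, so the quotient rule gives the
   multiplier 4 (b - 3) (b + 2) / (b^2 - 2 b - 7) at 1.  With b = a + i c and
   t = c^2, the difference of the squared moduli of numerator and denominator
   is a quadratic polynomial in t, increasing for t >= 0, whose larger root (when
   real) is the radicand of [nu a].  That root is nonnegative iff the constant
   term (3 a^2 - 2 a - 17) (5 a^2 - 6 a - 31) is at most 0, and the roots of this
   quartic in a are the endpoints of the intervals for a. *)
Require Import Defs.
From mathcomp Require Import all_boot all_order all_algebra.
From mathcomp Require Import all_classical all_reals all_analysis.
From mathcomp Require Import complex ring lra.

Import Order.TTheory GRing.Theory Num.Theory.
Import numFieldNormedType.Exports.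

Local Open Scope ring_scope.
Local Open Scope complex_scope.

Lemma is_derive_horner (K : numFieldType) (p : {poly K}) (x : K) :
  is_derive (x : K^o) (1 : K^o) (horner p : K^o -> K^o) (p^`().[x] : K^o).
Proof.
elim/poly_ind: p => [|p c IHp].
  rewrite deriv0 horner0 (_ : horner 0 = cst 0); first exact: is_derive_cst.
  by apply/funext => y; rewrite horner0.
have -> : horner (p * 'X + c%:P) = (horner p : K^o -> K) * id + cst c.
  by apply/funext => y; rewrite !hornerE.
apply: is_derive_eq.
by rewrite derivMXaddC !hornerE /GRing.scale /=; ring.
Qed.

Lemma horner_neq0_near (K : numFieldType) (q : {poly K}) (x : K) :
  q.[x] != 0 -> \forall z \near (x : K^o), q.[z] != 0.
Proof.
move=> qx0.
have /differentiable_continuous q_cont :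
    differentiable (horner q : K^o -> K^o) (x : K^o).
  by apply/derivable1_diffP; case: (is_derive_horner _ q x).
exact: cvgr_neq0 q_cont qx0.
Qed.

(** Since [q = d * g], the gcd [g] is nonzero at [z] too, so it cancels from the fraction of
    values. *)
Lemma ratmapE (R : realType) (p q : {poly R[i]}) (z : R[i]) :
  q.[z] != 0 -> ratmap p q (Some z) = Some (p.[z] / q.[z]).
Proof.
move=> qz0; have := divpK (dvdp_gcdr p q); have := divpK (dvdp_gcdl p q).
rewrite /ratmap; set g := gcdp p q; set n := p %/ g; set d := q %/ g.
move=> pE qE; move: qz0; rewrite -qE -pE !hornerM mulf_eq0 negb_or.
by case/andP => dz gz; rewrite (negPf dz) -mulf_div divff ?mulr1.
Qed.

Lemma ratmap_multiplier (R : realType) (p q : {poly R[i]}) (z : R[i]) :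
  q.[z] != 0 -> p.[z] = z * q.[z] ->
  fixed_with_multiplier (ratmap p q) z
    ((p^`().[z] * q.[z] - p.[z] * q^`().[z]) / q.[z] ^+ 2).
Proof.
move=> qz0 pz; split; first by rewrite ratmapE // pz mulfK.
(* The derivative depends only on the germ at [z], and there the map is the plain quotient. *)
have /near_eq_is_derive : \forall w \near (z : R[i]^o),
    (horner p : R[i]^o -> R[i]^o) w * (q.[w])^-1 = affine_part (ratmap p q) w.
  by near=> w; rewrite /affine_part ratmapE //; near: w; exact: horner_neq0_near.
apply.
have dp := is_derive_horner _ p z; have [dq1 dq2] := is_derive_horner _ q z.
have dqV : is_derive (z : R[i]^o) (1 : R[i]^o) (fun w => (q.[w])^-1 : R[i]^o)
    (- q.[z] ^- 2 * q^`().[z]).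
  apply: DeriveDef; first exact: derivableV.
  by rewrite deriveV // dq2.
apply: is_derive_eq.
by rewrite /GRing.scale /=; field.
Unshelve. all: by end_near. Qed.

Definition multiplier {R : realType} (b : R[i]) : R[i] :=
  4 * (b - 3) * (b + 2) / (b ^+ 2 - 2 * b - 7).

Lemma Oop_multiplier {R : realType} (b : R[i]) :
  b ^+ 2 - 2 * b - 7 != 0 -> fixed_with_multiplier (Oop b) 1 (multiplier b).
Proof.
move=> M0.
have hornerE1 := (hornerXn, hornerD, hornerN, hornerM, hornerC, hornerX).
(* At 1, denominator and numerator both equal the sum of the same two coefficients, which makes 1 a
   fixed point. *)
have den1 : (Oop_den b).[1] = 2 * (b ^+ 2 - 2 * b - 7).
  by rewrite /Oop_den !hornerE1; ring.
have num1 : (Oop_num b).[1] = 2 * (b ^+ 2 - 2 * b - 7).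
  by rewrite /Oop_num !hornerE1 expr1n; ring.
have den0 : (Oop_den b).[1] != 0 by rewrite den1 mulf_neq0 // pnatr_eq0.
have := @ratmap_multiplier R (Oop_num b) (Oop_den b) 1 den0.
rewrite num1 den1 mul1r => /(_ erefl); rewrite -/(Oop b).
congr (fixed_with_multiplier _ _ _); rewrite /multiplier.
rewrite /Oop_den /Oop_num !poly.derivE !hornerE1 !expr1n.
by field; exact: M0.
Qed.

(* |4 (b - 3) (b + 2)|^2 - |b^2 - 2 b - 7|^2 for b = a + i c and t = c^2. *)
Definition defect {R : realType} (a t : R) : R :=
  15 * t ^+ 2 + (30 * a ^+ 2 - 28 * a + 190) * t
  + (3 * a ^+ 2 - 2 * a - 17) * (5 * a ^+ 2 - 6 * a - 31).

Lemma multiplier_norm {R : realType} (a c : R) (b := a +i* c) :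
  b ^+ 2 - 2 * b - 7 != 0 ->
  exists2 k : R, 0 < k & `|multiplier b| ^+ 2 - 1 = (defect a (c ^+ 2) * k)%:C.
Proof.
move=> M0.
pose u := a ^+ 2 - c ^+ 2 - 2 * a - 7; pose v := 2 * a * c - 2 * c.
have ME : b ^+ 2 - 2 * b - 7 = u +i* v.
  rewrite /b /u /v; apply/eqP; rewrite eq_complex /=.
  by apply/andP; split; apply/eqP; ring.
have uv0 : 0 < u ^+ 2 + v ^+ 2.
  rewrite lt0r addr_ge0 ?sqr_ge0 // andbT paddr_eq0 ?sqr_ge0 // !sqrf_eq0.
  by move: M0; rewrite ME eq_complex.
(* This is the inverse squared modulus of the denominator of [multiplier b]. *)
exists (u ^+ 2 + v ^+ 2)^-1; first by rewrite invr_gt0.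
rewrite /multiplier normf_div expr_div_n ME -!add_Re2_Im2 /=.
rewrite -[X in _ - X]/((1 : R)%:C) -fmorph_div -rmorphB /=; congr (_%:C).
have : u ^+ 2 + v ^+ 2 != 0 by rewrite gt_eqF.
by rewrite /defect /u /v => ?; field.
Qed.

(** Completing the square gives [15 * defect a t = c ^+ 2 - 16 * D], with [c] as below. If [D] is
    nonnegative this is [(c - 4 * S) * (c + 4 * S)], whose second factor is positive and whose first
    is 15 times the difference on the right. *)
Lemma defect_sg {R : realType} (a t : R) : 0 <= t ->
  Num.sg (defect a t) = Num.sg (t - (- 95 + 14 * a - 15 * a ^+ 2
             + 4 * Num.sqrt (2 * (35 - 160 * a + 173 * a ^+ 2))) / 15).
Proof.
move=> t0; set D := 2 * _; set S := Num.sqrt D.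
pose c := 15 * t + 15 * a ^+ 2 - 14 * a + 95.
have c_gt0 : 0 < c by rewrite /c; nra.
(* D is negative for a near 80/173; then S = 0 and both signs are 1. *)
have [D0|D0] := leP 0 D.
  have SS : S ^+ 2 = D by rewrite sqr_sqrtr.
  have S0 : 0 <= S := sqrtr_ge0 _.
  have -> : defect a t =
      (t - (- 95 + 14 * a - 15 * a ^+ 2 + 4 * S) / 15) * (c + 4 * S).
    have -> : (t - (- 95 + 14 * a - 15 * a ^+ 2 + 4 * S) / 15) * (c + 4 * S)
       = (c ^+ 2 - 16 * S ^+ 2) / 15 by rewrite /c; field.
    by rewrite SS /D /c /defect; field.
  by rewrite sgrM [Num.sg (c + _)]gtr0_sg ?mulr1 //; lra.
have -> : S = 0 by apply: ler0_sqrtr; exact: ltW.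
rewrite !gtr0_sg //; first by rewrite /c in c_gt0; lra.
have -> : defect a t = (c ^+ 2 - 16 * D) / 15 by rewrite /D /c /defect; field.
by rewrite divr_gt0 //; nra.
Qed.

(** These bounds and those on the root of 41 are sharp enough to order the four interval
    endpoints. *)
Lemma sqrt13_bounds {R : realType} :
  18 / 5 < Num.sqrt 13 :> R /\ Num.sqrt 13 < 37 / 10 :> R.
Proof.
have h := @sqr_sqrtr R 13 (ler0n _ _).
have := sqrtr_ge0 (13 : R); set s := Num.sqrt _ in h *.
by move=> s0; split; nra.
Qed.

Lemma sqrt41_bounds {R : realType} :
  32 / 5 < Num.sqrt 41 :> R /\ Num.sqrt 41 < 65 / 10 :> R.
Proof.
have h := @sqr_sqrtr R 41 (ler0n _ _).
have := sqrtr_ge0 (41 : R); set s := Num.sqrt _ in h *.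
by move=> s0; split; nra.
Qed.

Lemma quartic_lt0 {R : realDomainType} (r1 r2 r3 r4 x : R) :
  r1 < r2 -> r2 < r3 -> r3 < r4 ->
  ((x - r1) * (x - r2) * ((x - r3) * (x - r4)) < 0) =
  (x \in `]r1, r2[) || (x \in `]r3, r4[).
Proof.
move=> r12 r23 r34; rewrite !in_itv /=.
have sgE r : Num.sg (x - r) = if x < r then -1 else if r < x then 1 else 0.
  have [xr|xr|->] := ltgtP x r; last by rewrite subrr sgr0.
    by rewrite ltr0_sg // subr_lt0.
  by rewrite gtr0_sg // subr_gt0.
rewrite -sgr_lt0 !sgrM !sgE.
have [?|?|?] := ltgtP x r1; have [?|?|?] := ltgtP x r2;
  have [?|?|?] := ltgtP x r3; have [?|?|?] := ltgtP x r4;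
  rewrite ?mulr0 ?mul0r ?mulrN1 ?mulr1 ?opprK ?oppr_lt0 ?ltxx ?ltr01 ?ltr10 //=; lra.
Qed.

Lemma quartic_le0 {R : realDomainType} (r1 r2 r3 r4 x : R) :
  r1 < r2 -> r2 < r3 -> r3 < r4 ->
  ((x - r1) * (x - r2) * ((x - r3) * (x - r4)) <= 0) =
  (x \in `[r1, r2]) || (x \in `[r3, r4]).
Proof.
move=> r12 r23 r34; rewrite le_eqVlt quartic_lt0 // !mulf_eq0 !subr_eq0 !in_itv /=.
have [?|?|?] := ltgtP x r1; have [?|?|?] := ltgtP x r2;
  have [?|?|?] := ltgtP x r3; have [?|?|?] := ltgtP x r4;
  rewrite //=; lra.
Qed.

Lemma defect0_roots {R : realType} (a : R)
    (r1 := (1 - 2 * Num.sqrt 13) / 3) (r2 := (3 - 2 * Num.sqrt 41) / 5)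
    (r3 := (1 + 2 * Num.sqrt 13) / 3) (r4 := (3 + 2 * Num.sqrt 41) / 5) :
  (defect a 0 < 0) = (a \in `]r1, r2[) || (a \in `]r3, r4[) /\
  (defect a 0 <= 0) = (a \in `[r1, r2]) || (a \in `[r3, r4]).
Proof.
have [s1 s2] := @sqrt13_bounds R; have [u1 u2] := @sqrt41_bounds R.
have s13 := @sqr_sqrtr R 13 (ler0n _ _).
have s41 := @sqr_sqrtr R 41 (ler0n _ _).
rewrite /r1 /r2 /r3 /r4; move: s1 s2 u1 u2 s13 s41.
move: (Num.sqrt 13) (Num.sqrt 41) => s u s1 s2 u1 u2 s13 s41.
rewrite -quartic_lt0 -?quartic_le0; [|lra..].
set P := (X in _ = (X < 0) /\ _).
have -> : defect a 0 = 15 * P.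
  (* Pairing the conjugate roots, [r1] with [r3] and [r2] with [r4], leaves only the squares of [s]
     and [u]. *)
  have -> : P = ((a - 1 / 3) ^+ 2 - 4 * s ^+ 2 / 9) *
                ((a - 3 / 5) ^+ 2 - 4 * u ^+ 2 / 25) by rewrite /P; field.
  by rewrite s13 s41 /defect; field.
by rewrite pmulr_rlt0 // pmulr_rle0.
Qed.

Lemma in_attracting_strip {R : realType} (a c : R) :
  (c \in `](- nu a), (nu a)[) = (defect a (c ^+ 2) < 0).
Proof.
rewrite -sgr_lt0 defect_sg ?sqr_ge0 // sgr_lt0 subr_lt0 in_itv /= -ltr_norml.
rewrite /nu -(sqrtr_sqr c); set t := (X in _ < Num.sqrt X).
have [t0|t0] := ltP 0 t; first by rewrite ltr_sqrt.
(* For a radicand at most 0, [Num.sqrt] returns 0: the strip is empty, and no square lies below the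
   radicand. *)
rewrite (ler0_sqrtr t0) !ltNge sqrtr_ge0; apply/esym/negbF.
exact: le_trans t0 (sqr_ge0 _).
Qed.

Lemma on_indifferent_curve {R : realType} (a c : R) : defect a 0 <= 0 ->
  c = nu a \/ c = - nu a <-> defect a (c ^+ 2) = 0.
Proof.
(* The hypothesis says that the radicand is nonnegative, so [nu a ^+ 2] is the radicand itself and
   not a default value. *)
rewrite -sgr_le0 defect_sg // sgr_le0 sub0r oppr_le0 => t0.
have -> : c = nu a \/ c = - nu a <-> c ^+ 2 == nu a ^+ 2.
  by rewrite eqf_sqr; split=> [[]->|/orP[]/eqP->]; rewrite ?eqxx ?orbT; auto.
rewrite sqr_sqrtr // -subr_eq0 -sgr_eq0 -defect_sg ?sqr_ge0 // sgr_eq0.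
by split=> [/eqP|->].
Qed.

(** This yields the condition on [alpha]: a defect that is negative or zero at [beta ^+ 2] forces
    the same bound at 0, hence places [alpha] in the intervals. *)
Lemma defect_ge {R : realType} (a t : R) : 0 <= t -> defect a 0 <= defect a t.
Proof.
move=> t0; rewrite -subr_ge0.
rewrite (_ : _ - _ = t * (15 * t + (30 * a ^+ 2 - 28 * a + 190))).
  by rewrite mulr_ge0 //; nra.
by rewrite /defect; ring.
Qed.

Theorem proposition4 (R : realType) (b : R[i]) (alpha beta : R)
    (hb : b = alpha +i* beta)
    (hbp : b <> (1 + 2 * Num.sqrt 2)%:C) (hbm : b <> (1 - 2 * Num.sqrt 2)%:C) :
  (attracting_region alpha beta -> attractive (Oop b) 1) /\
  (b = -2 \/ b = 3 -> superattractor (Oop b) 1) /\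
  (indifferent_region alpha beta -> indifferent (Oop b) 1) /\
  (~ attracting_region alpha beta -> b <> -2 -> b <> 3 ->
   ~ indifferent_region alpha beta -> repulsive (Oop b) 1).
Proof.
have M0 : b ^+ 2 - 2 * b - 7 != 0.
  (* The two excluded values are the roots of [b ^+ 2 - 2 * b - 7], recovered from their sum and
     product. *)
  set p := (1 + _)%:C in hbp; set m := (1 - _)%:C in hbm.
  have pDm : p + m = 2.
    by rewrite -rmorphD -[RHS](rmorph_nat (real_complex R)); congr (_%:C); ring.
  have pMm : p * m = - 7.
    rewrite -rmorphM -[7](rmorph_nat (real_complex R)) -rmorphN; congr (_%:C).
    have s2 := @sqr_sqrtr R 2 (ler0n _ _).
    have -> : (1 + 2 * Num.sqrt 2) * (1 - 2 * Num.sqrt 2)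
        = 1 - 4 * Num.sqrt 2 ^+ 2 :> R by ring.
    by rewrite s2; ring.
  have -> : b ^+ 2 - 2 * b - 7 = (b - p) * (b - m) by rewrite -pDm -pMm; ring.
  by rewrite mulf_neq0 // subr_eq0; apply/eqP.
have fixed := Oop_multiplier b M0.
have [k k0 lamE] : exists2 k : R, 0 < k &
    `|multiplier b| ^+ 2 - 1 = (defect alpha (beta ^+ 2) * k)%:C.
  by move: M0; rewrite hb => /multiplier_norm.
have [lt0E le0E] := defect0_roots alpha.
have K_le := defect_ge alpha _ (sqr_ge0 beta).
have lam_lt1 : (`|multiplier b| < 1) = (defect alpha (beta ^+ 2) < 0).
  by rewrite -(pmulr_llt0 _ k0) -ltcR -lamE subr_lt0 expr_lt1.
have lam_eq1 : (`|multiplier b| == 1) = (defect alpha (beta ^+ 2) == 0).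
  rewrite -(@pexpr_eq1 _ _ 2) // -subr_eq0 lamE fmorph_eq0 mulf_eq0.
  by rewrite (gt_eqF k0) orbF.
have lam_gt1 : (1 < `|multiplier b|) = (0 < defect alpha (beta ^+ 2)).
  by rewrite -(pmulr_lgt0 _ k0) -ltcR -lamE subr_gt0 expr_gt1.
split; [|split; [|split]].
- move=> [_]; rewrite in_attracting_strip => def_lt0.
  by exists (multiplier b); rewrite ?lam_lt1.
- move=> b23; exists (multiplier b) => //; rewrite /multiplier.
  by case: b23 => ->; rewrite ?subrr ?addNr ?mulr0 ?mul0r.
- move=> [/orP]; rewrite -le0E => K0 /(on_indifferent_curve _ _ K0) def0.
  by exists (multiplier b) => //; apply/eqP; rewrite lam_eq1 def0.
- move=> Nattr _ _ Nindiff; exists (multiplier b) => //; rewrite lam_gt1.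
  rewrite lt_neqAle; apply/andP; split.
    apply/eqP => /esym def0; apply: Nindiff.
    have K0 : defect alpha 0 <= 0 by rewrite (le_trans K_le) ?def0.
    by split; [apply/orP; rewrite -le0E | apply/on_indifferent_curve].
  rewrite leNgt; apply/negP => def_lt0; apply: Nattr.
  split; last by rewrite in_attracting_strip.
  by apply/orP; rewrite -lt0E (le_lt_trans K_le).
Qed.
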